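(* Let $(X,d)$ be a metric space, $f:X\to X$ a continuous map, $n,l\in\mathbb{N}$ with $n,l\geq 2$, $\beta=(m_1,m_2,\dots,m_n)\in\mathbb{N}^n$ and $\alpha=(k_1,k_2,\dots,k_l)\in\mathbb{N}^l$. Assume that to the indices $i=1,\dots,n$ one can assign pairwise different indices $j(i)\in\{1,\dots,l\}$ such that $m_i=k_{j(i)}$ for each $i$. If $(X,f)$ is $\alpha$-$l$-sensitive, then $(X,f)$ is $\beta$-$n$-sensitive.
   Context: $\mathbb{N}=\{1,2,3,\dots\}$. For $q\geq 2$ and $\eta=(e_1,\dots,e_q)\in\mathbb{N}^q$, $(X,f)$ is $\eta$-$q$-sensitive if there is $\delta>0$ such that for every nonempty open $U\subseteq X$ there are $k\in\mathbb{N}$ and $x_1,\dots,x_q\in U$ with $\min_{1\leq i<j\leq q}d(f^{e_ik}(x_i),f^{e_jk}(x_j))>\delta$. *)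

(* Defs.v *)
From mathcomp Require Import all_boot all_order all_algebra.
From mathcomp Require Import all_classical all_reals all_analysis.
Set Implicit Arguments.
Unset Strict Implicit.
Unset Printing Implicit Defensive.
Import Order.TTheory GRing.Theory Num.Theory.
Local Open Scope classical_set_scope.
Local Open Scope ring_scope.

(* The minimum is taken in \bar R so that the iterated operator has a neutral
   element; as soon as 2 <= q the range is nonempty and it is the ordinary
   minimum of real numbers. *)
Definition min_pairwise_dist (R : realType) (X : metricType R) (q : nat)
    (y : 'I_q -> X) : \bar R :=
  \big[Order.min/+oo%E]_(p : 'I_q * 'I_q | (p.1 < p.2)%N)
    (mdist (y p.1) (y p.2))%:E.

(* Meant for 2 <= q and positive entries e i.  Here the positive integers are
   rendered by nat with explicit positivity conditions. *)
Definition q_sensitive (R : realType) (X : metricType R) (f : X -> X)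
    (q : nat) (e : 'I_q -> nat) : Prop :=
  exists2 delta : R, 0 < delta &
    forall U : set X, open U -> U !=set0 ->
      exists k : nat, exists x : 'I_q -> X,
        [/\ (0 < k)%N,
            (forall i, U (x i)) &
            (delta%:E <
              min_pairwise_dist (fun i => iter (e i * k)%N f (x i)))%E].

(* Main.v *)
Require Import Defs.
From mathcomp Require Import all_boot all_order all_algebra.
From mathcomp Require Import all_classical all_reals all_analysis.
Import Order.TTheory.

(** Keep the same [delta] and the same time, and of the [l] separated points retain those indexed by
    [j i]. Since [m i = k (j i)], their iterates are unchanged, and injectivity of [j] keeps
    distinct indices distinct. As [j] may reverse order, symmetry of the distance is needed. *)

(* Stated for [i != j] rather than [i < j], so that it is stable under
   reindexing by injections that need not be monotone. *)
Lemma lt_min_pairwise_distP (R : realType) (X : metricType R) (q : nat)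
    (y : 'I_q -> X) (delta : R) :
  reflect (forall i j, i != j -> (delta < mdist (y i) (y j))%R)
    (delta%:E < min_pairwise_dist y)%E.
Proof.
apply: (iffP (bigmin_gtP _ _ _ _)) => [[_ H] i j|H].
  rewrite neq_ltn => /orP[] ij; last rewrite metric_sym.
    by have := H (i, j) ij; rewrite lte_fin.
  by have := H (j, i) ij; rewrite lte_fin.
(* The bound must also lie below the default value [+oo] of the iterated minimum. *)
split=> [|[i j] /= ij]; first by rewrite ltry.
by rewrite lte_fin H // neq_ltn ij.
Qed.

Theorem theorem5 (R : realType) (X : metricType R) (f : X -> X)
    (hf : continuous f) (n l : nat) (hn : (2 <= n)%N) (hl : (2 <= l)%N)
    (m : 'I_n -> nat) (hm : forall i, (0 < m i)%N)
    (k : 'I_l -> nat) (hk : forall i, (0 < k i)%N)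
    (hmk : exists j : 'I_n -> 'I_l,
       injective j /\ forall i, m i = k (j i)) :
  q_sensitive f k -> q_sensitive f m.
Proof.
case: hmk => j [j_inj mE] [delta delta_gt0 sens].
exists delta => // U oU U0.
have [t [x [t_gt0 xU /lt_min_pairwise_distP sep]]] := sens U oU U0.
exists t, (x \o j); split=> // [i|]; first exact: xU.
apply/lt_min_pairwise_distP => a b ab.
by rewrite !mE; apply: sep; rewrite (inj_eq j_inj).
Qed.
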